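(* Let $T$ be a set and let $X^*=\{X^*_t\}_{t\in T}$ be the Tawn–Molchanov (TM) process with ECF $\theta$. Let $\mu$ be the unique positive Radon measure on $\mathcal{P}(T)\setminus\{\varnothing\}$ with $$\theta(A)=\mu\bigl(\{Q\in\mathcal{P}(T)\setminus\{\varnothing\}:A\cap Q\neq\varnothing\}\bigr)\quad\text{for all }A\in\mathcal{F}(T).$$ Then $X^*$ has the following spectral representation $(\Omega,\mathcal{A},\nu,V)$: $(\Omega,\mathcal{A},\nu)$ is the measure space $(\mathcal{P}(T),\mathcal{B}(\mathcal{P}(T)),\mu)$, and the spectral functions are $V_t(Q)=\mathbf{1}_{t\in Q}$ for $t\in T$, $Q\in\mathcal{P}(T)$.
   Context: $\mathcal{F}(T)$ is the set of finite subsets of $T$. $\mathcal{P}(T)$ is the power set of $T$ with the topology generated by the maps $Q\mapsto\mathbf{1}_{t\in Q}$, $t\in T$ (i.e. $\{0,1\}^T$ with the product topology); $\mathcal{B}(\mathcal{P}(T))$ is its Borel $\sigma$-algebra. A Radon measure is a Borel measure that is finite on compact sets and inner regular (with respect to compact sets). A measure $\mu$ on $\mathcal{P}(T)\setminus\{\varnothing\}$ is regarded as a measure on $\mathcal{P}(T)$ giving no mass to the point $\varnothing$. Existence and uniqueness of $\mu$ as in the claim hold for every ECF $\theta$. Simple max-stable process: a process $X=\{X_t\}_{t\in T}$ with $\mathbb{P}(X_t\le x)=e^{-1/x}$ for all $t\in T$, $x>0$, such that for every $n\in\mathbb{N}$ and independent copies $X^{(1)},\dots,X^{(n)}$ of $X$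 the process $\{\bigvee_{i=1}^nX^{(i)}_t\}_{t\in T}$ has the same law (finite-dimensional distributions) as $\{nX_t\}_{t\in T}$. Extremal coefficient function (ECF) of a simple max-stable process $X$: $\theta:\mathcal{F}(T)\to[0,\infty)$ with $\theta(\varnothing)=0$ and $\theta(A)=-x\log\mathbb{P}(\bigvee_{t\in A}X_t\le x)$ for non-empty finite $A\subset T$ (independent of $x>0$). TM process with ECF $\theta$ (where $\theta$ is the ECF of some simple max-stable process on $T$): the simple max-stable process $X^*$ on $T$ (unique in law; its ECF is again $\theta$) with, for every non-empty finite $M\subset T$ and $x\in(0,\infty)^M$, $$-\log\mathbb{P}(X^*_t\le x_t,\ t\in M)=\sum_{\varnothing\neq L\subset M}\tau^M_L\bigvee_{t\in L}\frac1{x_t},\qquad \tau^M_L=\sum_{I\subset L}(-1)^{|I|+1}\theta\bigl((M\setminus L)\cup I\bigr).$$ Spectral representation: a simple max-stable process $X$ has spectral representation $(\Omega,\mathcal{A},\nu,V)$, where $(\Omega,\mathcal{A},\nu)$ is a measure space and $V_t:\Omega\to[0,\infty)$, $t\in T$, are measurable with $\int_\Omega V_t\,\mathrm{d}\nu=1$, if $X$ has the same law as $\{\bigvee_{(U,\omega)\in\Pi}U\,V_t(\omega)\}_{t\in T}$, where $\Pi$ is a Poisson point process on $(0,\infty)\times\Omega$ with intensity $u^{-2}\mathrm{d}u\times\nu(\mathrm{d}\omega)$. In terms of the finite-dimensional distributions this means $$-\log\mathbb{P}(X_t\le x_t,\ t\in M)=\int_\Omega\Bigl(\bigvee_{t\in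 M}\frac{V_t(\omega)}{x_t}\Bigr)\nu(\mathrm{d}\omega)$$ for all non-empty finite $M\subset T$ and $x\in(0,\infty)^M$. *)

(* Defs.v *)
From HB Require Import structures.
From mathcomp Require Import all_boot all_order all_algebra finmap.
From mathcomp Require Import all_classical all_reals all_analysis.
From mathcomp Require Import measurable_realfun.

Set Implicit Arguments.
Unset Strict Implicit.
Unset Printing Implicit Defensive.

Import Order.TTheory GRing.Theory Num.Theory.
Import numFieldNormedType.Exports.

Local Open Scope classical_set_scope.
Local Open Scope ring_scope.

Section Probability.
Context {R : realType}.

Definition same_fdd (T : Type) d (E : measurableType d)
    d1 (S1 : measurableType d1) (P1 : probability S1 R) (X1 : T -> S1 -> E)
    d2 (S2 : measurableType d2) (P2 : probability S2 R) (X2 : T -> S2 -> E) :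
    Prop :=
  forall (n : nat) (t : 'I_n -> T) (C : set (n.-tuple E)), measurable C ->
    P1 [set w | C [tuple X1 (t i) w | i < n]] =
    P2 [set w | C [tuple X2 (t i) w | i < n]].

Definition sigma_of (T : Type) d (E : measurableType d) (S : Type)
    (X : T -> S -> E) : set (set S) :=
  <<s [set F | exists (t : T) (B : set E), measurable B /\ F = X t @^-1` B] >>.

(* Intended for sigma-algebras [F i]: the product rule for subfamilies is the
   case [E i = setT] for the remaining indices. *)
Definition mutually_independent d (S : measurableType d) (P : probability S R)
    (I : finType) (F : I -> set (set S)) : Prop :=
  forall E : I -> set S, (forall i, F i (E i)) ->
    P (\bigcap_i E i) = (\prod_(i : I) P (E i))%E.

Definition point_count d (E : measurableType d) (S : Type) (Pi : S -> set E)
    (B : set E) (w : S) : \bar R := counting (Pi w `&` B).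

Definition poisson_law d (S : measurableType d) (P : probability S R)
    (N : S -> \bar R) (rate : \bar R) : Prop :=
  (rate = +oo%E -> P [set w | N w = +oo%E] = 1%E) /\
  (forall l : R, rate = l%:E -> forall k : nat,
     P [set w | N w = k%:R%:E] = (expR (- l) * l ^+ k / k`!%:R)%:E).

(* A point process is a random set of points; representing it by a set instead
   of a multiset loses nothing for the intensity used below, which does not
   charge any single level [u], so that points are almost surely distinct. *)
Definition poisson_point_process d (S : measurableType d) (P : probability S R)
    dE (E : measurableType dE) (intensity : set E -> \bar R)
    (Pi : S -> set E) : Prop :=
  [/\ forall B, measurable B -> measurable_fun setT (point_count Pi B : S -> \bar R),
      forall B, measurable B ->
        poisson_law P (point_count Pi B) (intensity B)
    & forall (n : nat) (B : 'I_n -> set E),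
        (forall i, measurable (B i)) -> trivIset setT B ->
        mutually_independent P
          (fun i => sigma_of
             (fun _ : unit => point_count Pi (B i) : S -> \bar R))].

End Probability.

Section MaxStable.
Context {R : realType} {T : choiceType}.

Section Process.
Context d (S : measurableType d) (P : probability S R).
Variable X : T -> {RV P >-> R}.

(* The maximum of the [n.+1] copies is taken with one of its own terms as the
   starting value, so it involves no additional term. *)
Definition simple_max_stable : Prop :=
  (forall (t : T) (x : R), 0 < x ->
     P [set w | X t w <= x] = (expR (- x^-1))%:E) /\
  (forall (n : nat) d' (S' : measurableType d') (P' : probability S' R)
     (Y : 'I_n.+1 -> T -> {RV P' >-> R}),
     (forall i, same_fdd P' (fun t => Y i t : S' -> R)
                         P (fun t => X t : S -> R)) ->
     mutually_independent P'
       (fun i => sigma_of (fun t => Y i t : S' -> R)) ->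
     same_fdd P' (fun t w => \big[Num.max/Y ord0 t w]_(i < n.+1) Y i t w)
              P (fun t w => n.+1%:R * X t w)).

(* [lne] is the extended logarithm, with [lne 0 = -oo]; a finite value of
   [- lne p] thus entails that the probability [p] is nonzero. *)
Definition neglog_cdf (M : {fset T}) (x : T -> R) : \bar R :=
  (- lne (P [set w | forall t, t \in M -> (X t w <= x t)%R]))%E.

Definition ecf_of (theta : {fset T} -> R) : Prop :=
  [/\ forall A, 0 <= theta A,
      theta fset0 = 0
    & forall (A : {fset T}) (x : R), A != fset0 -> 0 < x ->
        (theta A)%:E =
        (- (x%:E *
            lne (P [set w | \big[maxe/-oo]_(t <- A) (X t w)%:E <= x%:E])))%E].

Definition tau (theta : {fset T} -> R) (M L : {fset T}) : R :=
  \sum_(I <- fpowerset L) (-1) ^+ #|` I|.+1 * theta ((M `\` L) `|` I)%fset.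

(* In all formulas below maxima over finite index sets are maxima of
   nonnegative numbers, for which 0 is a neutral starting value. *)
Definition TM_process (theta : {fset T} -> R) : Prop :=
  simple_max_stable /\
  (forall (M : {fset T}) (x : T -> R), M != fset0 ->
     (forall t, t \in M -> 0 < x t) ->
     neglog_cdf M x =
     (\sum_(L <- fpowerset M | L != fset0)
        tau theta M L * \big[Num.max/0]_(t <- L) (x t)^-1)%:E).

(* The intensity [u^-2 du x nu(dw)] on [(0, oo) x Om], as an iterated integral;
   this makes sense without any finiteness assumption on [nu]. *)
Definition ppp_intensity dO (Om : measurableType dO)
    (nu : {measure set Om -> \bar R}) (B : set (R * Om)) : \bar R :=
  (\int[nu]_w \int[lebesgue_measure]_(u in `]0%R, +oo[)
     (\1_B (u, w) * u ^- 2)%:E)%E.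

(* Supremum in [[0, +oo]] of the values [u * V t w] at the points [(u, w)]; the
   empty supremum is 0. *)
Definition sup_process dO (Om : measurableType dO) (V : T -> Om -> R)
    (S' : Type) (Pi : S' -> set (R * Om)) (t : T) (s : S') : \bar R :=
  ereal_sup (0%E |` [set (p.1 * V t p.2)%:E | p in Pi s]).

(* [nu] is not assumed sigma-finite, so a Poisson process with the required
   intensity need not be available; the last clause, which is what the equality
   in law amounts to, is therefore stated along with it. *)
Definition spectral_representation dO (Om : measurableType dO)
    (nu : {measure set Om -> \bar R}) (V : T -> Om -> R) : Prop :=
  [/\ forall t, measurable_fun setT (V t),
      forall t w, 0 <= V t w,
      forall t, (\int[nu]_w (V t w)%:E)%E = 1%E,
      forall d' (S' : measurableType d') (P' : probability S' R)
        (Pi : S' -> set (R * Om)),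
        (forall s, Pi s `<=` [set p | 0 < p.1]) ->
        poisson_point_process P' (ppp_intensity nu) Pi ->
        same_fdd P (fun t w => (X t w)%:E) P' (sup_process V Pi)
    & forall (M : {fset T}) (x : T -> R), M != fset0 ->
        (forall t, t \in M -> 0 < x t) ->
        neglog_cdf M x =
        (\int[nu]_w (\big[Num.max/0]_(t <- M) (V t w / x t))%:E)%E].

End Process.

Definition is_ecf (theta : {fset T} -> R) : Prop :=
  exists d (S : measurableType d) (P : probability S R) (X : T -> {RV P >-> R}),
    simple_max_stable X /\ ecf_of X theta.

End MaxStable.

Notation borel E := (g_sigma_algebraType (@open E)).

(* A Radon measure on the subspace [D] of [E], regarded as a Borel measure on
   [E] giving no mass to the complement of [D] ([D] is meant to be Borel and
   [E] Hausdorff).  The compact subsets of the subspace [D] are the compact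
   subsets of [E] contained in [D]. *)
Definition radon_on {R : realType} (E : ptopologicalType) (D : set E)
    (mu : {measure set (borel E) -> \bar R}) : Prop :=
  [/\ mu (~` D) = 0%E,
      forall K : set E, compact K -> K `<=` D -> (mu K < +oo)%E
    & forall B : set (borel E), measurable B -> B `<=` D ->
        mu B = ereal_sup [set mu K | K in [set K : set E | compact K /\ K `<=` B]]].

(* [Q : powerset_space T] is the indicator function of a subset of [T]; bool
   carries the discrete topology. *)
Definition powerset_space (T : Type) : Type := {ptws T -> bool}.

HB.instance Definition _ (T : Type) := Pointed.on (powerset_space T).
HB.instance Definition _ (T : Type) := Topological.on (powerset_space T).

Definition nonempty_subsets (T : Type) : set (powerset_space T) :=
  [set Q | exists t, Q t].

(* Main.v *)
Require Import Defs.
From HB Require Import structures.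
From mathcomp Require Import all_boot all_order all_algebra finmap.
From mathcomp Require Import all_classical all_reals all_analysis.
From mathcomp Require Import measurable_realfun.

Set Implicit Arguments.
Unset Strict Implicit.
Unset Printing Implicit Defensive.

Import Order.TTheory GRing.Theory Num.Theory.
Import numFieldNormedType.Exports.

Local Open Scope classical_set_scope.
Local Open Scope ring_scope.

(** The coefficient [tau theta M L] is the Moebius inversion of the hitting
    functional [theta]: it equals [mu {Q | Q :&: M = L}].  Splitting
    [powerset_space T] according to the trace [L] of [Q] on [M] turns the
    integral of [max_(t in M) 1_(t in Q) / x t] into the TM formula.  For a
    Poisson process [Pi] with intensity [u^-2 du x mu], the event
    [sup_t <= x t] for all [t] in [M] says that [Pi] avoids a set whose
    intensity is that same integral, so both processes agree on positive
    orthants; these determine the laws because the margins charge no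
    nonpositive number. *)

(** * Moebius inversion of hitting functionals *)

(** Expanding the product picks [1] or [f t] in each factor, and the points where [f t] is picked
    form [I]. *)
Lemma sum_fpowerset_prod (A : comPzRingType) (T : choiceType) (f : T -> A)
    (L : {fset T}) :
  \sum_(I <- fpowerset L) \prod_(t <- I) f t = \prod_(t <- L) (1 + f t).
Proof.
elim/fset1U_rect: L => [|a L aL IH].
  by rewrite fpowerset0 big_seq_fset1 !big_seq_fset0.
have memI I : I \in fpowerset L -> a \notin I.
  by rewrite fpowersetE => /fsubsetP IL; apply: contra aL => /IL.
rewrite big_fsetU1//= -IH mulrDl mul1r mulr_sumr.
(* Subsets of the enlarged set either avoid [a], or arise from a unique subset of [L] by adding
   [a]. *)
have powU : perm_eq (fpowerset (a |` L)%fset)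
    (enum_fset (fpowerset L) ++ map (fsetU [fset a]%fset) (fpowerset L)).
  apply: uniq_perm => [//||I].
    rewrite cat_uniq fset_uniq /= map_inj_in_uniq ?fset_uniq ?andbT.
      apply/hasPn => _ /mapP[I _ ->]; apply/negP => /memI.
      by rewrite fset1U1.
    move=> I J /memI aI /memI aJ /(congr1 (fun K => K `\ a)%fset).
    by rewrite !fsetU1K.
  rewrite mem_cat fpowersetE; apply/idP/orP => [IaL|[|]].
  - have [aI|aI] := boolP (a \in I); [right|left].
      apply/mapP; exists (I `\ a)%fset; last by rewrite fsetD1K.
      by rewrite fpowersetE fsubDset.
    rewrite fpowersetE -(fsetU1K aL); apply/fsubsetP => t tI.
    rewrite fsetU1K//; have := fsubsetP IaL _ tI.
    by rewrite !inE => /orP[/eqP ta|//]; rewrite ta (negbTE aI) in tI.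
  - by rewrite fpowersetE => /fsubset_trans; apply; rewrite fsubsetU1.
  - by case/mapP => J; rewrite fpowersetE => JL ->; rewrite fsetUS.
rewrite (perm_big _ powU) big_cat/= big_map; congr (_ + _).
by apply: eq_big_seq => I /memI aI; rewrite big_fsetU1.
Qed.

Lemma prod_natr_all (A : comPzRingType) (I : Type) (s : seq I) (p : pred I) :
  \prod_(i <- s) (p i)%:R = (all p s)%:R :> A.
Proof.
by elim: s => [|i s IH]; rewrite ?big_nil// big_cons IH -natrM mulnb.
Qed.

(** This is the case of a unit point mass at the set [q], whose hitting functional is [has q].
    Integration carries it over to [mu], since [tau] is linear in [theta]. *)
Lemma tau_has (R : realType) (T : choiceType) (q : pred T) (M L : {fset T}) :
  (L `<=` M)%fset -> L != fset0 ->
  tau (fun A => (has q A)%:R) M L = (L == [fset t in M | q t]%fset)%:R :> R.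
Proof.
move=> LM L0.
(* With [has q A = 1 - \prod_(t in A) (1 - q t)] both alternating sums over
   subsets of [L] factor into products over [L], the first of which is 0. *)
pose c : R := (~~ has q (M `\` L)%fset)%:R.
have hasE I : (has q ((M `\` L) `|` I)%fset)%:R =
    1 - c * \prod_(t <- I) (~~ q t)%:R.
  rewrite (prod_natr_all _ I (predC q)) all_predC -natrM mulnb -negb_or.
  have -> : has q ((M `\` L) `|` I)%fset = has q (M `\` L)%fset || has q I.
    apply/hasP/orP => [[t]|].
      by rewrite inE => /orP[] tI qt; [left|right]; apply/hasP; exists t.
    by case=> /hasP[t tI qt]; exists t => //; rewrite inE tI ?orbT.
  by case: (_ || _); rewrite ?subr0 ?subrr.
have signE (I : {fset T}) : (-1) ^+ #|` I| = \prod_(t <- I) (-1 : R).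
  by rewrite big_const_seq count_predT -Monoid.iteropE.
rewrite /tau; under eq_bigr do rewrite hasE exprS mulN1r mulNr mulrBr mulr1 opprB.
rewrite big_split/= sumrN.
under eq_bigr do rewrite mulrCA signE -big_split/=.
rewrite -mulr_sumr sum_fpowerset_prod.
under [X in _ - X]eq_bigr do rewrite signE.
rewrite sum_fpowerset_prod subrr.
have -> : \prod_(t <- L) (1 + -1 * (~~ q t)%:R) = (all q L)%:R :> R.
  rewrite -prod_natr_all; apply: eq_bigr => t _.
  by case: (q t); rewrite ?mulr0 ?addr0// mulr1 subrr.
have -> : \prod_(t <- L) 0 = 0 :> R.
  have [t tL] := fset0Pn _ L0.
  by rewrite (big_fsetD1 t)//= mul0r.
(* What remains is the indicator that [q] misses [M] minus [L] and contains [L], so that [L] is its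
   trace on [M]. *)
rewrite -natrM mulnb subr0; congr (_%:R); congr nat_of_bool.
apply/andP/eqP => [[/hasPn ML /allP Lq]|->].
  apply/fsetP => t; rewrite !inE; apply/idP/andP => [tL|[tM qt]].
    by rewrite (fsubsetP LM)//; split=> //; exact: Lq.
  by apply: contraTT qt => tL; apply: ML; rewrite !inE tL.
split.
  by apply/hasPn => t; rewrite !inE => /andP[+ tM]; rewrite tM.
by apply/allP => t; rewrite !inE => /andP[].
Qed.

(** By [tau_has] only the summand at the trace [L0] of [q] on [M] survives, and points outside [q]
    contribute [0] to the maximum. *)
Lemma bigmax_indic_tau (R : realType) (T : choiceType) (q : pred T)
    (M : {fset T}) (x : T -> R) :
  (forall t, t \in M -> 0 < x t) ->
  \big[Num.max/0]_(t <- M) ((q t)%:R / x t) =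
  \sum_(L <- fpowerset M | L != fset0)
    tau (fun A => (has q A)%:R) M L * \big[Num.max/0]_(t <- L) (x t)^-1.
Proof.
move=> x0.
pose L0 : {fset T} := [fset t in M | q t]%fset.
transitivity (\big[Num.max/0]_(t <- L0) (x t)^-1).
  apply/eqP; rewrite eq_le; apply/andP; split; rewrite [leLHS]big_seq.
    apply: bigmax_le => [|t tM]; first exact: bigmax_ge_id.
    have [qt|_] := boolP (q t); last by rewrite mul0r bigmax_ge_id.
    by rewrite mul1r; apply: (le_bigmax_seq _ t predT) => //; rewrite !inE tM.
  apply: bigmax_le => [|t]; first exact: bigmax_ge_id.
  rewrite !inE/= => /andP[tM qt].
  rewrite (_ : (x t)^-1 = (q t)%:R / x t); last by rewrite qt mul1r.
  by apply: (le_bigmax_seq _ t predT).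
have memL : L0 \in fpowerset M.
  by rewrite fpowersetE; apply/fsubsetP => t; rewrite !inE => /andP[].
transitivity (\sum_(L <- fpowerset M | L != fset0)
    (L == L0)%:R * \big[Num.max/0]_(t <- L) (x t)^-1); last first.
  rewrite big_seq_cond [RHS]big_seq_cond; apply: eq_bigr => L /andP[].
  by rewrite fpowersetE => LM Lneq0; rewrite tau_has.
(* An empty trace is not a summation index; both sides are then [0]. *)
have [L00|Lneq0] := eqVneq L0 fset0.
  rewrite L00 [LHS]big_seq big_pred0; last by move=> t; rewrite inE.
  by rewrite big1// => L /negbTE ->; rewrite mul0r.
rewrite big_mkcond (big_fsetD1 L0)//= Lneq0 eqxx mul1r big1_seq ?addr0// => L.
by case/andP => _; rewrite !inE => /andP[/negbTE -> _]; rewrite mul0r if_same.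
Qed.

(** * Linearity of the integral and the tail of [u ^- 2] *)

Section HasIntegral.
Context d (Om : measurableType d) (R : realType).
Variable nu : {measure set Om -> \bar R}.

(** The terms of [tau] have alternating signs, so linearity of the integral requires integrability
    along with the value. *)
Definition has_integral (f : Om -> R) (v : R) :=
  nu.-integrable setT (EFin \o f) /\ (\int[nu]_w (f w)%:E)%E = v%:E.

Lemma has_integral_lincomb (I : Type) (s : seq I) (p : pred I) (c : I -> R)
    (f : I -> Om -> R) (v : I -> R) :
  (forall i, p i -> has_integral (f i) (v i)) ->
  has_integral (fun w => \sum_(i <- s | p i) c i * f i w)
               (\sum_(i <- s | p i) c i * v i).
Proof.
move=> fv.
elim: s => [|i s [IHi IHe]].
  rewrite big_nil (_ : (fun w => _) = cst 0); last first.
    by apply/funext => w; rewrite big_nil.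
  by split; [exact: integrable0 | rewrite integral0].
rewrite big_cons; have [pi|npi] := boolP (p i); last first.
  rewrite (_ : (fun w => _) = fun w => \sum_(i <- s | p i) c i * f i w)//.
  by apply/funext => w; rewrite big_cons (negbTE npi).
have [fi fe] := fv i pi.
have cfi := integrableZl measurableT (c i) fi.
rewrite (_ : (fun w => _) =
    fun w => c i * f i w + \sum_(i <- s | p i) c i * f i w); last first.
  by apply/funext => w; rewrite big_cons pi.
split; first by exact: (integrableD measurableT cfi IHi).
under eq_integral do rewrite EFinD EFinM.
by rewrite integralD// integralZl// fe IHe.
Qed.

End HasIntegral.

(** The antiderivative [- u^-1] tends to [0] at [+oo]; closing the ray at [c] adds only a null
    set. *)
Lemma integral_gt_inv_sqr (R : realType) (c : R) : 0 < c ->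
  (\int[lebesgue_measure]_(u in `]c, +oo[) (u ^- 2)%:E = (c^-1)%:E)%E.
Proof.
move=> c0.
have dinv (u : R) : 0 < u -> is_derive u 1 (fun y => - y^-1) (u ^- 2).
  move=> u0; have -> : u ^- 2 = - (- u ^- 2 *: 1) :> R.
    by rewrite scaler1 opprK.
  by apply: is_deriveN; apply: is_deriveV; rewrite gt_eqF.
have cinv (u : R) : 0 < u -> {for u, continuous (fun y : R => y ^- 2)}.
  move=> u0; apply: cvgV; last exact: exprn_continuous.
  by rewrite expf_neq0// gt_eqF.
have cc : {within `[c, +oo[, continuous (fun y : R => y ^- 2)}.
  apply: continuous_in_subspaceT => u; rewrite inE/= in_itv/= andbT => cu.
  by apply: cinv; exact: lt_le_trans cu.
rewrite integral_itv_obnd_cbnd; last first.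
  apply/measurable_EFinP; apply: (@measurable_funS _ _ _ _ `[c, +oo[) => //.
    by apply: subset_itvr; rewrite bnd_simp.
  exact: subspace_continuous_measurable_fun.
rewrite (@ge0_continuous_FTC2y _ _ (fun y => - y^-1) c 0).
- by rewrite sub0e -EFinN opprK.
- by move=> u cu; rewrite invr_ge0 sqr_ge0.
- exact: cc.
- rewrite -oppr0; apply: cvgN; apply/gtr0_cvgV0.
    by near=> u; near: u; exact: nbhs_pinfty_gt.
  exact: cvg_id.
- by move=> u cu; have /dinv[] : 0 < u by apply: lt_trans cu.
- apply: cvg_at_right_filter; apply: cvgN; apply: cvgV => //.
  by rewrite gt_eqF.
- move=> u; rewrite in_itv/= andbT => cu; rewrite derive1E.
  by have /dinv[_ ->] : 0 < u by apply: lt_trans cu.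
Unshelve. all: by end_near. Qed.

(** * Laws of tuples of extended reals *)

(** Lower orthants are stable under intersection and generate the product sigma-algebra. With all
    bounds [+oo] they include the whole space, so two probabilities agreeing on them are equal. *)
Lemma law_tuple_unique (R : realType) n d (S : measurableType d)
    (P : probability S R) d' (S' : measurableType d') (P' : probability S' R)
    (X : 'I_n -> S -> \bar R) (Y : 'I_n -> S' -> \bar R) :
  (forall i, measurable_fun setT (X i)) ->
  (forall i, measurable_fun setT (Y i)) ->
  (forall a : 'I_n -> \bar R,
    P [set w | forall i, (X i w <= a i)%E] =
    P' [set w | forall i, (Y i w <= a i)%E]) ->
  forall C : set (n.-tuple \bar R), measurable C ->
    P [set w | C [tuple X i w | i < n]] = P' [set w | C [tuple Y i w | i < n]].
Proof.
move=> mX mY XY.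
pose G := [set A : set (n.-tuple \bar R) |
  exists a : 'I_n -> \bar R, A = [set y | forall i, (tnth y i <= a i)%E]].
have mtX : measurable_fun setT (fun w => [tuple X i w | i < n]).
  apply/measurable_fun_tnthP => i; rewrite (_ : _ \o _ = X i)//.
  by apply/funext => w /=; rewrite tnth_mktuple.
have mtY : measurable_fun setT (fun w => [tuple Y i w | i < n]).
  apply/measurable_fun_tnthP => i; rewrite (_ : _ \o _ = Y i)//.
  by apply/funext => w /=; rewrite tnth_mktuple.
have GT : G setT.
  by exists (fun=> +oo%E); apply/seteqP; split=> // y _ i; rewrite leey.
have mG : measurable = <<s G >>.
  apply/seteqP; split.
    apply: smallest_sub; first exact: smallest_sigma_algebra.
    move=> A; rewrite -bigcup_seq/= => -[i _ [B mB <-]].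
    have mi : measurable_fun setT
        (fun y : g_sigma_algebraType G => tnth (y : n.-tuple _) i).
      apply: (measurability _ (ErealGenOInfty.measurableE R)).
      move=> _ [_ [r ->] <-]; rewrite setTI.
      rewrite (_ : _ @^-1` _ = ~` [set y | (tnth y i <= r%:E)%E]).
        apply: measurableC; apply: sub_sigma_algebra.
        (* The bound [+oo] leaves every coordinate other than [i] free. *)
        exists (fun j => if j == i then r%:E else +oo%E).
        apply/seteqP; split => y /= H; last by have := H i; rewrite eqxx.
        by move=> j; case: eqP => [->//|_]; rewrite leey.
      by apply/seteqP; split=> y /=; rewrite in_itv/= andbT ltNge => /negP.
    exact: mi.
  apply: smallest_sub; first exact: sigma_algebra_measurable.
  move=> _ [a ->].
  rewrite (_ : [set _ | _] =
    \big[setI/setT]_(i < n) ((fun y => tnth y i) @^-1` `]-oo, a i])); last first.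
    rewrite -bigcap_seq; apply/seteqP; split=> y /= H i.
      by move=> _; rewrite /= in_itv/=.
    by have := H i; rewrite /= mem_index_enum in_itv/=; exact.
  apply: bigsetI_measurable => i _; rewrite -[_ @^-1` _]setTI.
  by apply: measurable_tnth => //; exact: emeasurable_itv.
move=> C mC.
apply: (measure_unique G (fun=> setT) mG _ _ _
  (pushforward P (fun w => [tuple X i w | i < n]))
  (pushforward P' (fun w => [tuple Y i w | i < n]))) => //.
- move=> A B [a ->] [b ->]; exists (fun i => mine (a i) (b i)).
  apply/seteqP; split=> y /= => [[ya yb] i|yab]; first by rewrite le_min ya yb.
  by split=> i; have := yab i; rewrite le_min => /andP[].
- by apply/seteqP; split=> // y _; exists 0%N.
- move=> A [a ->]; rewrite /pushforward/=.
  have E T0 (Z : 'I_n -> T0 -> \bar R) : (fun w => [tuple Z i w | i < n]) @^-1`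
     [set y | forall i, (tnth y i <= a i)%E] = [set w | forall i, (Z i w <= a i)%E].
    by apply/seteqP; split=> w /= H i; have := H i; rewrite tnth_mktuple.
  by move: (XY a); rewrite -(E _ X) -(E _ Y).
- move=> _; rewrite -[X in (X < _)%E]/(P setT).
  by rewrite probability_setT ltry.
Qed.

(** * Integrals of the spectral maximum *)

(** For each [w], [bigmax_indic_tau] applies to the set of [t] with [V t w]. Its right-hand side is
    a linear combination of hitting indicators, which are integrable with integrals [theta A]. *)
Lemma integral_bigmax_tau (R : realType) (T : choiceType)
    d (Om : measurableType d) (nu : {measure set Om -> \bar R})
    (V : T -> Om -> bool) (theta : {fset T} -> R) (M : {fset T}) (x : T -> R) :
  (forall t, measurable [set w | V t w]) ->
  (forall A : {fset T},
    nu [set w | exists2 t, t \in A & V t w] = (theta A)%:E) ->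
  (forall t, t \in M -> 0 < x t) ->
  (\int[nu]_w (\big[Num.max/0]_(t <- M) ((V t w)%:R / x t))%:E =
  (\sum_(L <- fpowerset M | L != fset0)
     tau theta M L * \big[Num.max/0]_(t <- L) (x t)^-1)%:E)%E.
Proof.
move=> mV nuV x0.
have hasI (A : {fset T}) :
    has_integral nu (fun w => (has (V^~ w) A)%:R) (theta A).
  have -> : (fun w => (has (V^~ w) A)%:R) =
      \1_[set w | exists2 t, t \in A & V t w] :> (Om -> R).
    apply/funext => w; rewrite indicE; congr (_%:R); congr nat_of_bool.
    by apply/hasP/idP; rewrite inE.
  have mA : measurable [set w | exists2 t, t \in A & V t w].
    have -> : [set w | exists2 t, t \in A & V t w] =
        \big[setU/set0]_(t <- A) [set w | V t w].
      rewrite -bigcup_seq; apply/seteqP; split => w /= [t tA Vt].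
        by exists t.
      by exists t.
    by apply: bigsetU_measurable => t _; exact: mV.
  have intA : (\int[nu]_w (\1_[set w | exists2 t, t \in A & V t w] w)%:E =
      (theta A)%:E)%E.
    by rewrite integral_indic// setIT nuV.
  split=> //; apply/integrableP; split.
    by apply/measurable_EFinP; exact: measurable_indic.
  under eq_integral do rewrite /= ger0_norm//.
  by rewrite intA ltry.
pose m (L : {fset T}) : R := \big[Num.max/0]_(t <- L) (x t)^-1.
have tauI (L : {fset T}) : has_integral nu
    (fun w => tau (fun A => (has (V^~ w) A)%:R) M L) (tau theta M L).
  by apply: has_integral_lincomb => I _; exact: hasI.
have [_ sumI] : has_integral nu
    (fun w => \sum_(L <- fpowerset M | L != fset0)
      m L * tau (fun A => (has (V^~ w) A)%:R) M L)
    (\sum_(L <- fpowerset M | L != fset0) m L * tau theta M L).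
  by apply: has_integral_lincomb => L _; exact: tauI.
under [in RHS]eq_bigr do rewrite mulrC.
rewrite -sumI; apply: eq_integral => w _; rewrite (bigmax_indic_tau (V^~ w))//.
by congr (_%:E); apply: eq_bigr => L _; rewrite mulrC.
Qed.

(** For fixed [w] the positive levels [u] in the set are those with [u^-1 < m], where [m] is the
    maximum on the right. If [m > 0] they form the ray beyond [m^-1], on which [u ^- 2] has integral
    [m]. *)
Lemma ppp_intensity_exceedance (R : realType) (T : choiceType)
    d (Om : measurableType d) (nu : {measure set Om -> \bar R})
    (V : T -> Om -> R) (M : {fset T}) (x : T -> R) :
  (forall t w, 0 <= V t w) -> (forall t, t \in M -> 0 < x t) ->
  ppp_intensity nu [set p | exists2 t, t \in M & x t < p.1 * V t p.2] =
  (\int[nu]_w (\big[Num.max/0]_(t <- M) (V t w / x t))%:E)%E.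
Proof.
move=> V0 x0; apply: eq_integral => w _.
set m := \big[Num.max/0]_(t <- M) _.
have m0 : 0 <= m by exact: bigmax_ge_id.
have exceedE u : 0 < u ->
    (exists2 t, t \in M & x t < u * V t w) <-> u^-1 < m.
  move=> u0; split=> [[t tM]|].
    rewrite mulrC -ltr_pdivrMr// => h; apply: (@lt_le_trans _ _ (V t w / x t)).
      by rewrite ltr_pdivlMr ?x0// mulrC.
    by apply: (le_bigmax_seq _ t predT).
  move=> um; apply: contrapT => h; move: um; apply/negP; rewrite -leNgt.
  rewrite /m big_seq; apply: bigmax_le => [|t tM]; first by rewrite invr_ge0 ltW.
  rewrite ler_pdivrMr ?x0// mulrC ler_pdivlMr// mulrC leNgt; apply/negP => xt.
  by apply: h; exists t.
(* The case [m = 0] stands apart because [0^-1] is [0] by convention, whereas no positive level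
   belongs to the set. *)
move: m0; rewrite le_eqVlt => /predU1P[m0|m0].
  rewrite -m0 integral0_eq// => u; rewrite /= in_itv/= andbT => u0.
  rewrite indicE memNset ?mul0r//= => /exceedE; rewrite -m0 => /(_ u0).
  by rewrite ltNge invr_ge0 ltW.
have mV0 : 0 < m^-1 by rewrite invr_gt0.
rewrite -[in RHS](invrK m) -integral_gt_inv_sqr//.
rewrite integral_mkcond [RHS]integral_mkcond; apply: eq_integral => u _.
rewrite !patchE !mem_setE !in_itv/= !andbT.
have [u0|u0] := ltP 0 u; last by rewrite ltNge (le_trans u0 (ltW mV0)).
rewrite indicE; have [mu|mu] := ltP m^-1 u.
  rewrite mem_set ?mul1r//=; apply/exceedE => //.
  by rewrite -[m]invrK ltf_pV2// ?posrE.
rewrite memNset ?mul0r//= => /exceedE => /(_ u0).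
by rewrite ltNge -[m]invrK lef_pV2// ?posrE// mu.
Qed.

(** * Suprema over a Poisson process *)

Lemma counting_eq0 (R : realType) (T : choiceType) (A : set T) :
  counting A = 0%E :> \bar R <-> A = set0.
Proof.
rewrite /counting; split=> [|->]; last by rewrite asboolT// fset_set0.
case: asboolP => // fA [] /eqP; rewrite pnatr_eq0 cardfs_eq0 => /eqP.
by move=> /fset_set_set0 ->.
Qed.

Section SupProcess.
Context {R : realType} {T : choiceType} dO (Om : measurableType dO).
Variables (V : T -> Om -> R) (S : Type) (Pi : S -> set (R * Om)).

Lemma sup_process_leP (t : T) (s : S) (c : R) : 0 <= c ->
  (sup_process V Pi t s <= c%:E)%E <->
  (forall p, Pi s p -> p.1 * V t p.2 <= c).
Proof.
move=> c0; split=> [/ereal_supP h p pPi|h].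
  by rewrite -lee_fin; apply: h; right; exists p.
by apply/ereal_supP => _ [->|[p pPi <-]]; rewrite lee_fin//; exact: h.
Qed.

(** An event about suprema becomes one about a count of points, for which the Poisson hypothesis
    supplies measurability and law. The bounds must be nonnegative because [0] is among the values
    under the supremum. *)
Lemma sup_process_le_void (M : {fset T}) (x : T -> R) :
  (forall t, t \in M -> 0 <= x t) ->
  [set s | forall t, t \in M -> (sup_process V Pi t s <= (x t)%:E)%E] =
  [set s | point_count Pi
    [set p | exists2 t, t \in M & x t < p.1 * V t p.2] s = 0%E :> \bar R].
Proof.
move=> x0; apply/seteqP; split=> s /=.
  move=> h; apply/counting_eq0/seteqP; split=> // p [pPi [t tM]].
  by rewrite ltNge; have /sup_process_leP -> := h _ tM => //; exact: x0.
move=> /counting_eq0 h t tM; apply/sup_process_leP; first exact: x0.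
move=> p pPi; rewrite leNgt; apply/negP => xp.
by have : set0 p by rewrite -h; split=> //; exists t.
Qed.

Lemma sup_process_ge0 (t : T) (s : S) : (0 <= sup_process V Pi t s)%E.
Proof. by apply: ereal_sup_ubound; left. Qed.

End SupProcess.

Lemma measurable_exceedance (R : realType) (T : choiceType)
    d (Om : measurableType d) (V : T -> Om -> R) (M : {fset T}) (x : T -> R) :
  (forall t, measurable_fun setT (V t)) ->
  measurable [set p : R * Om | exists2 t, t \in M & x t < p.1 * V t p.2].
Proof.
move=> mV.
have -> : [set p : R * Om | exists2 t, t \in M & x t < p.1 * V t p.2] =
    \big[setU/set0]_(t <- M) [set p | x t < p.1 * V t p.2].
  by rewrite -bigcup_seq; apply/seteqP; split => w /= [t tA Vt]; exists t.
apply: bigsetU_measurable => t _.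
rewrite (_ : [set p | _] = (fun p : R * Om => p.1 * V t p.2) @^-1` `]x t, +oo[).
  rewrite -[_ @^-1` _]setTI.
  have mf : measurable_fun setT (fun p : R * Om => p.1 * V t p.2).
    by apply: measurable_funM => //; exact: measurableT_comp.
  by apply: mf.
by apply/seteqP; split=> p /=; rewrite in_itv/= andbT.
Qed.

Lemma measurable_sup_process (R : realType) (T : choiceType)
    dO (Om : measurableType dO) (V : T -> Om -> R)
    d (S : measurableType d) (P : probability S R)
    (intensity : set (R * Om) -> \bar R) (Pi : S -> set (R * Om)) (t : T) :
  (forall t, measurable_fun setT (V t)) ->
  poisson_point_process P intensity Pi ->
  measurable_fun setT (sup_process V Pi t).
Proof.
move=> mV [mPi _ _].
apply: (measurability _ (ErealGenOInfty.measurableE R)).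
move=> _ [_ [r ->] <-]; rewrite setTI.
(* A negative level is always exceeded; for the others the event is the complement of a void
   event. *)
have [r0|r0] := ltP r 0.
  rewrite (_ : _ @^-1` _ = setT)//; apply/seteqP; split=> // s _ /=.
  by rewrite in_itv/= andbT (lt_le_trans _ (sup_process_ge0 _ _ _ _))// lte_fin.
rewrite (_ : _ @^-1` _ = ~` [set s | forall u, u \in [fset t]%fset ->
    (sup_process V Pi u s <= r%:E)%E]); last first.
  apply/seteqP; split=> s /=; rewrite in_itv/= andbT ltNge.
    by move=> /negP h /(_ t); rewrite inE eqxx => /(_ isT).
  by move=> h; apply/negP => tr; apply: h => u; rewrite inE => /eqP ->.
rewrite (sup_process_le_void _ _ (fun _ _ => r0)).
apply: measurableC.
rewrite -[X in measurable X]setTI.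
have := mPi _ (@measurable_exceedance _ _ _ _ V [fset t]%fset (fun=> r) mV).
by move=> /(_ measurableT [set 0%E]); apply; exact: emeasurable_set1.
Qed.

(** The event says that the exceedance set contains no point. Its rate is the finite number [l], so
    [poisson_law] at [k = 0] gives the probability. *)
Lemma sup_process_orthant (R : realType) (T : choiceType)
    dO (Om : measurableType dO) (nu : {measure set Om -> \bar R})
    (V : T -> Om -> R) d (S : measurableType d) (P : probability S R)
    (Pi : S -> set (R * Om)) (M : {fset T}) (x : T -> R) (l : R) :
  (forall t, measurable_fun setT (V t)) -> (forall t w, 0 <= V t w) ->
  poisson_point_process P (ppp_intensity nu) Pi ->
  (forall t, t \in M -> 0 < x t) ->
  (\int[nu]_w (\big[Num.max/0]_(t <- M) (V t w / x t))%:E)%E = l%:E ->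
  P [set s | forall t, t \in M -> (sup_process V Pi t s <= (x t)%:E)%E] =
  (expR (- l))%:E.
Proof.
move=> mV V0 [_ lawPi _] x0 il.
rewrite sup_process_le_void; last by move=> t tM; exact/ltW/x0.
have [_ /(_ l)] := lawPi _ (@measurable_exceedance _ _ _ _ V M x mV).
rewrite ppp_intensity_exceedance// => /(_ il 0%N) ->.
by rewrite expr0 fact0 mulr1 divr1.
Qed.

(** * Reduction of the law to positive orthants *)

(** This passes from tuples, with repeated indices and infinite bounds, to finite sets with real
    bounds, as in the TM formula. Repeated indices are merged by taking the least bound, and indices
    with bound [+oo] are dropped. *)
Lemma lower_orthant_fset (R : realType) (T : choiceType) n (t : 'I_n -> T)
    (a : 'I_n -> \bar R) :
  (forall i, (0 < a i)%E) ->
  exists (M : {fset T}) (x : T -> R), (forall s, s \in M -> 0 < x s) /\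
    forall z : T -> \bar R,
      (forall i, (z (t i) <= a i)%E) <-> (forall s, s \in M -> (z s <= (x s)%:E)%E).
Proof.
move=> a0.
pose b s := (\big[mine/+oo]_(i | t i == s) a i)%E.
have b0 s : (0 < b s)%E by apply: lt_bigmin => //; rewrite ltry.
have bfin s : (b s < +oo)%E -> (fine (b s))%:E = b s.
  by move=> bs; rewrite fineK// ge0_fin_numE// ltW.
exists [fset s in [seq t i | i : 'I_n] | (b s < +oo)%E]%fset, (fine \o b).
split=> [s|z].
  by rewrite !inE/= => /andP[_ bs]; rewrite fine_gt0// b0.
split=> [za s|zM i].
  rewrite !inE/= => /andP[_ /bfin ->].
  by apply: le_bigmin => [|i /eqP <-]; rewrite ?leey.
apply: (@le_trans _ _ (b (t i))); last by apply: bigmin_le_cond.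
have [/[dup] bti /bfin <-|] := ltP (b (t i)) +oo%E.
  by apply: zM; rewrite !inE/= bti andbT; apply/mapP; exists i; rewrite ?mem_enum.
by rewrite leye_eq => /eqP ->; rewrite leey.
Qed.

Lemma measurable_sublevel (R : realType) d (S : measurableType d)
    (Z : S -> \bar R) (c : \bar R) :
  measurable_fun setT Z -> measurable [set w | (Z w <= c)%E].
Proof.
move=> mZ; rewrite (_ : [set w | _] = Z @^-1` `]-oo, c]).
  by rewrite -[X in measurable X]setTI; apply: mZ => //; exact: emeasurable_itv.
by apply/seteqP; split=> w /=; rewrite in_itv.
Qed.

(** If this probability [r] were positive, the choice [x = r] would give [r <= expR (- r^-1)],
    contradicting [expR y >= 1 + y > y] at [y = r^-1]. *)
Lemma frechet_le0 (R : realType) d (S : measurableType d)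
    (P : probability S R) (Z : S -> \bar R) :
  measurable_fun setT Z ->
  (forall x : R, 0 < x -> P [set w | (Z w <= x%:E)%E] = (expR (- x^-1))%:E) ->
  P [set w | (Z w <= 0)%E] = 0%E.
Proof.
move=> mZ PZ.
have /EFin_fin_numP[r rE] := fin_num_measure P _ (measurable_sublevel 0%E mZ).
have r0 : 0 <= r by rewrite -lee_fin -rE.
rewrite rE; congr (_%:E); apply/eqP; rewrite eq_le r0 andbT leNgt; apply/negP => {}r0.
have : r <= expR (- r^-1).
  rewrite -lee_fin -rE -PZ//.
  apply: le_measure; rewrite ?inE; [exact: measurable_sublevel..|].
  move=> w /= /le_trans; apply.
  by rewrite lee_fin ltW.
apply/negP; rewrite -ltNge expRN -[ltRHS]invrK ltf_pV2 ?posrE ?invr_gt0 ?expR_gt0//.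
by apply: lt_le_trans (expR_ge1Dx _); rewrite ltrDr ltr01.
Qed.

(** By [law_tuple_unique] lower orthants suffice. Those with positive bounds reduce to the
    hypothesis, and those with a bound at most [0] are null on both sides by [frechet_le0]. *)
Lemma same_fdd_frechet (R : realType) (T : choiceType)
    d (S : measurableType d) (P : probability S R) (X : T -> S -> \bar R)
    d' (S' : measurableType d') (P' : probability S' R) (Y : T -> S' -> \bar R) :
  (forall t, measurable_fun setT (X t)) ->
  (forall t, measurable_fun setT (Y t)) ->
  (forall t (x : R), 0 < x ->
    P [set w | (X t w <= x%:E)%E] = (expR (- x^-1))%:E) ->
  (forall (M : {fset T}) (x : T -> R), (forall t, t \in M -> 0 < x t) ->
    P [set w | forall t, t \in M -> (X t w <= (x t)%:E)%E] =
    P' [set w | forall t, t \in M -> (Y t w <= (x t)%:E)%E]) ->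
  same_fdd P X P' Y.
Proof.
move=> mX mY PX XY n t; apply: law_tuple_unique => // a.
(* Agreement on singletons [M] transfers the Fréchet margins from [X] to [Y]. *)
have PY u (x : R) : 0 < x -> P' [set w | (Y u w <= x%:E)%E] = (expR (- x^-1))%:E.
  move=> x0; rewrite -(PX u)//.
  have := XY [fset u]%fset (fun=> x) (fun _ _ => x0).
  have single Q0 (Z : T -> Q0 -> \bar R) :
      [set w | forall s, s \in [fset u]%fset -> (Z s w <= x%:E)%E] =
      [set w | (Z u w <= x%:E)%E].
    apply/seteqP; split=> w /=; first by apply; rewrite inE.
    by move=> h s; rewrite inE => /eqP ->.
  by rewrite (single _ X) (single _ Y).
have [a0|/existsNP[i /negP]] := pselect (forall i, (0 < a i)%E).
  have [M [x [x0 Mx]]] := lower_orthant_fset t a0.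
  have orthE Q0 (Z : T -> Q0 -> \bar R) :
      [set w | forall i, (Z (t i) w <= a i)%E] =
      [set w | forall s, s \in M -> (Z s w <= (x s)%:E)%E].
    by apply/seteqP; split=> w /= /(Mx (Z^~ w)).
  by rewrite (orthE _ X) (orthE _ Y) XY.
rewrite -leNgt => ai0.
have null d0 (Q0 : measurableType d0) (Pr : probability Q0 R) (Z : T -> Q0 -> \bar R) :
    (forall t, measurable_fun setT (Z t)) ->
    (forall t (x : R), 0 < x ->
      Pr [set w | (Z t w <= x%:E)%E] = (expR (- x^-1))%:E) ->
    Pr [set w | forall i, (Z (t i) w <= a i)%E] = 0%E.
  move=> mZ PZ.
  apply/eqP; rewrite eq_le measure_ge0 andbT.
  rewrite -(frechet_le0 (mZ (t i)) (PZ (t i))); apply: le_measure.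
  - rewrite inE (_ : [set _ | _] =
        \bigcap_(j in [set: 'I_n]) [set w | (Z (t j) w <= a j)%E]).
      by apply: fin_bigcap_measurable => // j _; exact: measurable_sublevel.
    by apply/seteqP; split=> w /= h j; [move=> _|]; apply: h.
  - by rewrite inE; exact: measurable_sublevel.
  - by move=> w /(_ i) /le_trans; apply.
by rewrite (null _ _ P X)// (null _ _ P' Y).
Qed.

(** * Spectral representation of the TM process *)

Theorem theorem18 (R : realType) (T : choiceType) (theta : {fset T} -> R)
  (d : measure_display) (S : measurableType d) (P : probability S R)
  (X : T -> {RV P >-> R})
  (mu : {measure set (borel (powerset_space T)) -> \bar R})
  (theta_ecf : is_ecf theta)
  (X_TM : TM_process X theta)
  (mu_radon : radon_on (@nonempty_subsets T) mu)
  (mu_theta : forall A : {fset T},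
     (theta A)%:E = mu [set Q | nonempty_subsets Q /\ exists2 t, t \in A & Q t]) :
  spectral_representation X mu
    (fun (t : T) (Q : borel (powerset_space T)) => (Q t)%:R).
Proof.
(* Evaluation at [t] is continuous for the product topology, so this set is open. *)
have mV (t : T) : measurable [set Q : borel (powerset_space T) | Q t].
  apply: sub_sigma_algebra.
  have ct : continuous (fun Q : powerset_space T => Q t).
    exact: (@proj_continuous T (fun=> bool : topologicalType) t).
  have /continuousP h := ct.
  exact: (h [set true] (discrete_open _)).
have hitE (A : {fset T}) :
    mu [set Q | exists2 t, t \in A & Q t] = (theta A)%:E.
  rewrite mu_theta; congr (mu _); apply/seteqP; split=> Q /=; last by case.
  by move=> QA; split=> //; have [t _ Qt] := QA; exists t.
have mV' (t : T) :
    measurable_fun setT (fun Q : borel (powerset_space T) => (Q t)%:R : R).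
  rewrite (_ : (fun _ => _) = \1_[set Q : borel (powerset_space T) | Q t]).
    exact: measurable_indic.
  apply/funext => Q; rewrite indicE; congr (_%:R); congr nat_of_bool.
  by apply/idP/idP; rewrite inE.
have [[XF _] XTM] := X_TM.
have spectral (M : {fset T}) (x : T -> R) : M != fset0 ->
    (forall t, t \in M -> 0 < x t) ->
    neglog_cdf X M x =
    (\int[mu]_Q (\big[Num.max/0]_(t <- M) ((Q t)%:R / x t))%:E)%E.
  by move=> M0 x0; rewrite XTM// (integral_bigmax_tau (theta := theta)).
(* The normalisation is read off at level [1] from the Fréchet margin of the process that realises
   [theta]. *)
have theta1 (t : T) : theta [fset t]%fset = 1.
  have [d0 [S0 [P0 [X0 [[X0F _] [_ _ thetaE]]]]]] := theta_ecf.
  apply: EFin_inj; rewrite (thetaE _ 1)//; last by apply/fset0Pn; exists t; rewrite inE.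
  rewrite mul1e.
  rewrite (_ : [set w | _] = [set w | X0 t w <= 1]); last first.
    by apply/seteqP; split=> w /=; rewrite big_seq_fset1 lee_fin.
  by rewrite X0F// invr1 lne_EFin ?expR_gt0// expRK EFinN oppeK.
split.
- exact: mV'.
- by move=> t Q; exact: ler0n.
- move=> t.
  transitivity (\int[mu]_Q (\1_[set Q : borel (powerset_space T) | Q t] Q)%:E)%E.
    apply: eq_integral => Q _; rewrite indicE; congr (_%:R%:E); congr nat_of_bool.
    by apply/idP/idP; rewrite inE.
  rewrite integral_indic// setIT -(theta1 t) -hitE.
  congr (mu _); apply/seteqP; split=> Q /=; first by exists t; rewrite ?inE.
  by case=> s; rewrite inE => /eqP ->.
- move=> d' S' P' Pi _ ppp; apply: same_fdd_frechet.
  + by move=> t; apply/measurable_EFinP.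
  + by move=> t; apply: measurable_sup_process ppp.
  + by move=> t x x0; rewrite -(XF t).
  move=> M x x0.
  (* The TM formula concerns non-empty [M]; for the empty set both events are certain. *)
  have [->|M0] := eqVneq M fset0.
    have all0 Q0 (Z : T -> Q0 -> \bar R) :
        [set w | forall t, t \in fset0 -> (Z t w <= (x t)%:E)%E] = setT.
      by apply/seteqP; split=> // w _ t; rewrite inE.
    by rewrite (all0 _ (fun t w => (X t w)%:E)) all0 !probability_setT.
  have := XTM M x M0 x0; rewrite /neglog_cdf.
  set l := \sum_(L <- _ | _) _ => Pl.
  rewrite (@sup_process_orthant _ _ _ _ mu _ _ _ _ _ _ _ l mV' _ ppp x0)//.
    (* The TM formula gives [- lne p] for the probability [p]; the exponential inverts [lne] on the
       nonnegative extended reals and recovers [p]. *)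
    rewrite -[LHS]lneK ?in_itv/= ?measure_ge0 ?leey//.
    by rewrite -[lne _]oppeK [X in (- X)%E]Pl.
  by rewrite -spectral// XTM.
- exact: spectral.
Qed.
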